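(* Let $\mu\subset\mathbb{N}$ be an increasing sequence. There exists a sequence $a=(a_1,a_2,\dots)$ of real numbers such that, for every continuous real function $f$ on $[0,1]$ vanishing at $0$, there exists an increasing sequence $(\lambda_n)_n\subset\mu$ of integers such that $$\sum_{k=1}^{\lambda_n}a_k x^k(1-x)^{\lambda_n-k}\rightarrow f(x)\quad\text{as }n\rightarrow+\infty,\text{ uniformly on }[0,1].$$ The set of such sequences $a$ is a dense $G_\delta$ subset of $\mathbb{R}^{\mathbb{N}}$ and contains, apart from $0$, a dense subspace of $\mathbb{R}^{\mathbb{N}}$, but it is not spaceable.
   Context: $\mathbb{R}^{\mathbb{N}}$ (sequences here being indexed from $1$) carries the product topology. ''Increasing'' for index sequences means strictly increasing. A subset of $\mathbb{R}^{\mathbb{N}}$ contains a subspace apart from $0$ if it contains all its non-zero elements; it is spaceable if it contains, apart from $0$, an infinite-dimensional closed subspace of $\mathbb{R}^{\mathbb{N}}$. *)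

(* Defs.v *)
From HB Require Import structures.
From mathcomp Require Import all_boot all_order all_algebra.
From mathcomp Require Import all_classical all_reals all_analysis.

Set Implicit Arguments.
Unset Strict Implicit.
Unset Printing Implicit Defensive.

Import Order.TTheory GRing.Theory Num.Theory.
Import numFieldNormedType.Exports.

Local Open Scope classical_set_scope.
Local Open Scope ring_scope.

Section LinearTopological.
Context {K : numDomainType}.

Definition linear_subspace {V : lmodType K} (W : set V) : Prop :=
  GRing.submod_closed (mem W).

Definition finite_dimensional {V : lmodType K} (W : set V) : Prop :=
  exists (n : nat) (e : 'I_n -> V), (forall i, W (e i)) /\
    forall w, W w -> exists c : 'I_n -> K, w = \sum_(i < n) c i *: e i.

Definition contains_apart_from_0 {V : lmodType K} (A W : set V) : Prop :=
  W `\ 0 `<=` A.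

Definition spaceable {V : preTopologicalLmodType K} (A : set V) : Prop :=
  exists W : set V, [/\ linear_subspace W, closed W,
    ~ finite_dimensional W & contains_apart_from_0 A W].

End LinearTopological.

(* [{ptws nat -> R^o}] carries the product topology; the vector space structure
   is the coordinatewise one of the plain function type.  Coordinate [i] of
   such a function stands for the term of index [i + 1] of a sequence indexed
   from 1. *)
Definition rseq (R : realType) : Type := {ptws nat -> R^o}.

HB.instance Definition _ (R : realType) :=
  Topological.copy (rseq R) {ptws nat -> R^o}.
HB.instance Definition _ (R : realType) :=
  GRing.Lmodule.copy (rseq R) (nat -> R^o).

Definition term {R : realType} (a : rseq R) (k : nat) : R := a k.-1.

Definition bernstein_sum {R : realType} (a : rseq R) (n : nat) (x : R) : R :=
  \sum_(1 <= k < n.+1) term a k * x ^+ k * (1 - x) ^+ (n - k).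

Definition universal {R : realType} (mu : nat -> nat) : set (rseq R) :=
  [set a | forall f : R -> R, {within `[0, 1], continuous f} -> f 0 = 0 ->
    exists lambda : nat -> nat,
      [/\ {homo lambda : i j / (i < j)%N},
          range lambda `<=` range mu &
          {uniform `[0, 1],
            (fun n => bernstein_sum a (lambda n)) @ \oo --> f}]].

(* Main.v *)
Require Import Defs.
From HB Require Import structures.
From mathcomp Require Import all_boot all_order all_algebra.
From mathcomp Require Import all_classical all_reals all_analysis borel_hierarchy.
From mathcomp Require Import ring lra.

Import Order.TTheory GRing.Theory Num.Theory.
Import numFieldNormedType.Exports.

Local Open Scope classical_set_scope.
Local Open Scope ring_scope.

(** Put [S_n a = bernstein_sum a n].

    If [a_k = 'C(n, k) f (k / n)] for every [k], then [S_n a] is the n-th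
    Bernstein polynomial of [f].  As [f 0 = 0] and ['C(n, k) >= n] for
    [0 < k < n], prescribing finitely many terms of [a] changes it by a quantity
    that tends to 0 uniformly, so any finite prefix extends to one with
    [S_n a] close to [f].  Universality is a countable intersection of such
    conditions (rational coefficients suffice), each open and met by an extension
    of any prefix: this gives the G_delta property and density.

    For the dense subspace, choose [a^0, a^1, ...] and nested subsequences [mu_j]
    of [mu] such that [a^j] is universal along [mu_j], [S a^i] tends to 0 along
    [mu_j] for [i < j], and the first terms of [a^j] are [0, ..., 0, 1].  In a
    linear combination the last nonzero coefficient alone decides universality.

    An infinite-dimensional subspace contains vectors with arbitrarily late
    leading terms; when it is closed, their infinite combinations stay in it.
    Since [|S_m a| <= 1] on [[0, 1]] bounds the first m coefficients of [a] by a
    constant depending only on [m], making the coefficient of each leading index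
    huge with respect to the constants up to the next leading index forces
    [sup |S_m a| > 1] for all large [m], so [f = 0] is not approximated. *)

(** * Bernstein's approximation theorem *)

(** Expectation of [g] under the binomial law with parameters [n] and [x]; [g k = f (k / n)] gives
    the Bernstein polynomials of [f]. *)
Definition binomial_mean {R : realType} (n : nat) (g : nat -> R) (x : R) : R :=
  \sum_(k < n.+1) g k * ('C(n, k)%:R * (x ^+ k * (1 - x) ^+ (n - k))).

(** Pascal's rule, that is, conditioning on one Bernoulli trial. *)
Lemma binomial_meanS {R : realType} n (g : nat -> R) x :
  binomial_mean n.+1 g x =
  (1 - x) * binomial_mean n g x + x * binomial_mean n (g \o succn) x.
Proof.
rewrite /binomial_mean.
have -> : (1 - x) * \sum_(k < n.+1) g k * ('C(n, k)%:R * (x ^+ k * (1 - x) ^+ (n - k)))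
    = \sum_(k < n.+2) g k * ('C(n, k)%:R * (x ^+ k * (1 - x) ^+ (n.+1 - k))).
  rewrite [RHS]big_ord_recr /= bin_small// mul0r mulr0 addr0 mulr_sumr.
  by apply: eq_bigr => k _; rewrite subSn ?exprS -1?ltnS//; ring.
rewrite big_ord_recl [in RHS]big_ord_recl /= !bin0 -addrA; congr (_ + _).
rewrite mulr_sumr -big_split; apply: eq_bigr => k _ /=.
by rewrite /bump /= add1n subSS binS natrD exprS; ring.
Qed.

Lemma binomial_mean_cst {R : realType} n (c x : R) :
  binomial_mean n (fun=> c) x = c.
Proof.
elim: n => [|n IH]; first by rewrite /binomial_mean big_ord1 bin0 subnn /=; ring.
by rewrite binomial_meanS /comp IH; ring.
Qed.

(** Variance plus squared bias. The centre [c] stays free because a success shifts it to [c - 1] in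
    the induction. *)
Lemma binomial_mean_sqr {R : realType} n (c x : R) :
  binomial_mean n (fun k => (k%:R - c) ^+ 2) x =
  n%:R * (x * (1 - x)) + (n%:R * x - c) ^+ 2.
Proof.
elim: n c => [|n IH] c; first by rewrite /binomial_mean big_ord1 bin0 subnn /=; ring.
rewrite binomial_meanS IH; have -> : (fun k => (k%:R - c) ^+ 2) \o succn =
    (fun k : nat => (k%:R - (c - 1)) ^+ 2).
  by apply/funext => k /=; rewrite -natr1; ring.
by rewrite IH -natr1; ring.
Qed.

Lemma binomial_weight_ge0 {R : realType} n k (x : R) : 0 <= x <= 1 ->
  0 <= 'C(n, k)%:R * (x ^+ k * (1 - x) ^+ (n - k)).
Proof.
by move=> /andP[x0 x1]; rewrite !mulr_ge0// exprn_ge0// subr_ge0.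
Qed.

Lemma binomial_meanB {R : realType} n (g h : nat -> R) x :
  binomial_mean n g x - binomial_mean n h x =
  binomial_mean n (fun k => g k - h k) x.
Proof. by rewrite -sumrB; apply: eq_bigr => k _; rewrite mulrBl. Qed.

Lemma normr_binomial_mean {R : realType} n (g h : nat -> R) x :
  0 <= x <= 1 -> (forall k, (k <= n)%N -> `|g k| <= h k) ->
  `|binomial_mean n g x| <= binomial_mean n h x.
Proof.
move=> x01 gh; apply: le_trans (ler_norm_sum _ _ _) _.
apply: ler_sum => k _.
rewrite normrM [X in _ * X]ger0_norm ?binomial_weight_ge0//.
by rewrite ler_wpM2r ?binomial_weight_ge0// gh// -ltnS.
Qed.

(** Continuity handles close points and boundedness of [f] distant ones. The quadratic form is the
    one whose binomial mean is computable. Compactness of [[0, 1]] makes [K] uniform. *)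
Lemma quadratic_modulus {R : realType} (f : R -> R) (e : R) :
  {within `[0, 1], continuous f} -> 0 < e ->
  exists2 K : R, 0 <= K & forall x y, 0 <= x <= 1 -> 0 <= y <= 1 ->
    `|f y - f x| <= e + K * (y - x) ^+ 2.
Proof.
move=> cf e0.
have near_f (x : R) : 0 <= x <= 1 -> forall d : R, 0 < d ->
    \forall z \near x, 0 <= z <= 1 -> `|f x - f z| < d.
  move=> x01 d d0.
  have := cf x => /cvgrPdist_lt/(_ _ d0).
  rewrite {1}/nbhs /= -nbhs_subspace_in; last by rewrite /= in_itv.
  move=> H; have {}H : \forall z \near x, z \in `[0, 1] -> `|f x - f z| < d.
    exact: H.
  by apply: filterS H => z zd z01; apply: zd; rewrite in_itv.
have [M fM] : exists M, forall x, 0 <= x <= 1 -> `|f x| <= M.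
  have := @segment_compact R 0 1 => /compact_near_coveringP.
  move=> /(_ _ (pinfty_nbhs R) (fun M x => 0 <= x <= 1 -> `|f x| <= M)).
  case.
    move=> x; rewrite /= in_itv /= => x01.
    exists ([set z | 0 <= z <= 1 -> `|f x - f z| < 1], [set M | `|f x| + 1 <= M]).
      by split=> /=; [exact: near_f|apply: nbhs_pinfty_ge; rewrite num_real].
    move=> [z M] /= [/[swap] fxM + z01] => /(_ z01).
    by have := ler_distD (f x) (f z) 0; rewrite !subr0 (distrC (f z)); lra.
  move=> M [_ /(_ (M + 1)) H]; exists (M + 1) => x x01.
  by apply: H => //=; rewrite ?ltrDl ?in_itv.
have := @segment_compact R 0 1 => /compact_near_coveringP.
move=> /(_ _ (pinfty_nbhs R) (fun K x => 0 <= x <= 1 -> forall y, 0 <= y <= 1 ->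
  `|f y - f x| <= e + K * (y - x) ^+ 2)).
case.
  move=> x; rewrite /= in_itv /= => x01.
  have /near_f/(_ (e / 2)) : 0 <= x <= 1 by [].
  case; first by rewrite divr_gt0.
  move=> d /= d0 xd; have d20 : 0 < d / 2 by rewrite divr_gt0.
  exists (ball x (d / 2), [set K | 0 <= K /\ 2 * M / (d / 2) ^+ 2 <= K]).
    split=> /=; first exact: nbhsx_ballx.
    by apply: filterI; apply: nbhs_pinfty_ge; rewrite num_real.
  move=> [z K] /= [xz [K0 MK]] z01 y y01.
  have {}xz : `|x - z| < d / 2 by [].
  (* Either [y] and [z] are both within [d] of [x], or they are at least [d / 2] apart and the
     quadratic term alone reaches [2 * M]. *)
  have [yd|yd] := ltP `|x - y| d.
    have := xd y yd y01; have /xd/(_ z01) : ball_ Num.norm x d z. by rewrite /=; lra.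
    have := ler_distD (f x) (f y) (f z); rewrite (distrC (f y) (f x)).
    have : 0 <= K * (y - z) ^+ 2 by rewrite mulr_ge0// sqr_ge0.
    lra.
  have yz : d / 2 <= `|y - z|.
    by have := ler_distD z x y; rewrite (distrC z y); lra.
  have := fM _ y01; have := fM _ z01.
  have : 2 * M <= K * (y - z) ^+ 2; last by have := ler_normB (f y) (f z); lra.
  move: MK; rewrite ler_pdivrMr ?exprn_gt0// => /le_trans; apply.
  rewrite ler_wpM2l// -[leRHS]real_normK ?num_real// ler_sqr ?nnegrE ?normr_ge0//.
  exact: ltW.
move=> K [_ /(_ (`|K| + 1)) H]; exists (`|K| + 1) => // x y x01 y01.
have /H : K < `|K| + 1 by rewrite (le_lt_trans (ler_norm K))// ltrDl.
by apply => //=; rewrite in_itv.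
Qed.

(** Chebyshev's argument: averaging the quadratic modulus leaves [e / 2] plus [K] times the variance
    [x (1 - x) / n], at most [K / n]. *)
Lemma bernstein_approximation {R : realType} (f : R -> R) (e : R) :
  {within `[0, 1], continuous f} -> 0 < e ->
  exists N, forall n, (N <= n)%N -> forall x, 0 <= x <= 1 ->
    `|binomial_mean n (fun k => f (k%:R / n%:R)) x - f x| <= e.
Proof.
move=> cf e0; have [//|K K0 fK] := @quadratic_modulus R f (e / 2) cf.
  by rewrite divr_gt0.
exists (Num.trunc (2 * K / e)).+1 => n Nn x x01.
have n0 : 0 < n%:R :> R by rewrite ltr0n (leq_trans _ Nn).
have Ken : K / n%:R <= e / 2.
  have : 2 * K / e < n%:R by rewrite (lt_le_trans (truncnS_gt _))// ler_nat.
  by rewrite ltr_pdivrMr// ler_pdivrMr//; lra.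
rewrite -[f x in X in X <= _](binomial_mean_cst n _ x) binomial_meanB.
apply: le_trans
  (_ : binomial_mean n (fun k => e / 2 + K * (k%:R / n%:R - x) ^+ 2) x <= _).
  apply: normr_binomial_mean => // k kn; apply: fK => //.
  by rewrite divr_ge0//= ler_pdivrMr// mul1r ler_nat.
have -> : binomial_mean n (fun k => e / 2 + K * (k%:R / n%:R - x) ^+ 2) x =
    e / 2 + K / n%:R ^+ 2 * binomial_mean n (fun k => (k%:R - n%:R * x) ^+ 2) x.
  rewrite -[e / 2 in RHS](binomial_mean_cst n _ x) /binomial_mean.
  rewrite mulr_sumr -big_split; apply: eq_bigr => k _ /=.
  by field; rewrite gt_eqF.
rewrite binomial_mean_sqr subrr expr0n addr0.
have -> : K / n%:R ^+ 2 * (n%:R * (x * (1 - x))) = K / n%:R * (x * (1 - x)).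
  by field; rewrite gt_eqF.
have : K / n%:R * (x * (1 - x)) <= K / n%:R.
  rewrite ler_piMr ?divr_ge0// ?ltW//; nra.
lra.
Qed.

(** * Sums with a prescribed prefix *)

Lemma bernstein_sumE {R : realType} (a : rseq R) n x :
  bernstein_sum a n x =
  \sum_(k < n) a k * (x ^+ k.+1 * (1 - x) ^+ (n - k.+1)).
Proof.
rewrite /bernstein_sum big_add1 big_mkord.
by apply: eq_bigr => k _; rewrite /term /= mulrA.
Qed.

Definition agree {T : Type} (n : nat) (a b : nat -> T) : Prop :=
  forall k, (k < n)%N -> a k = b k.

Lemma agreeW {T : Type} m n (a b : nat -> T) :
  (m <= n)%N -> agree n a b -> agree m a b.
Proof. by move=> mn ab k km; apply: ab; exact: leq_trans mn. Qed.

Lemma agree_trans {T : Type} n (a b c : nat -> T) :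
  agree n a b -> agree n b c -> agree n a c.
Proof. by move=> ab bc k kn; rewrite ab// bc. Qed.

Lemma eq_bernstein_sum {R : realType} (a b : rseq R) n x :
  agree n a b -> bernstein_sum a n x = bernstein_sum b n x.
Proof. by move=> ab; rewrite !bernstein_sumE; apply: eq_bigr => k _; rewrite ab. Qed.

Lemma bernstein_sum0 {R : realType} n (x : R) : bernstein_sum 0 n x = 0.
Proof. by rewrite bernstein_sumE big1// => k _; rewrite mul0r. Qed.

Lemma bernstein_sumD {R : realType} (a b : rseq R) n x :
  bernstein_sum (a + b) n x = bernstein_sum a n x + bernstein_sum b n x.
Proof.
rewrite !bernstein_sumE -big_split.
by apply: eq_bigr => k _; rewrite -[RHS]mulrDl.
Qed.

Lemma bernstein_sumZ {R : realType} c (a : rseq R) n x :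
  bernstein_sum (c *: a) n x = c * bernstein_sum a n x.
Proof.
rewrite !bernstein_sumE mulr_sumr.
by apply: eq_bigr => k _; rewrite [RHS]mulrA.
Qed.

Lemma bernstein_sum_at0 {R : realType} (a : rseq R) n : bernstein_sum a n 0 = 0.
Proof.
by rewrite bernstein_sumE big1// => k _; rewrite expr0n mul0r mulr0.
Qed.

Lemma continuous_bernstein_sum {R : realType} (a : rseq R) n :
  continuous (bernstein_sum a n).
Proof.
pose p : {poly R} := \sum_(k < n) a k *: ('X ^+ k.+1 * (1 - 'X) ^+ (n - k.+1)).
have -> : bernstein_sum a n = horner p; last exact: continuous_horner.
apply/funext => x; rewrite bernstein_sumE horner_sum.
by apply: eq_bigr => k _; rewrite !hornerE.
Qed.

Lemma bernstein_sum_dist {R : realType} (a b : rseq R) n e x : 0 <= x <= 1 ->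
  (forall k, (k < n)%N -> `|a k - b k| <= e) ->
  `|bernstein_sum a n x - bernstein_sum b n x| <= n%:R * e.
Proof.
move=> /andP[x0 x1] abe; rewrite !bernstein_sumE -sumrB.
apply: le_trans (ler_norm_sum _ _ _) _.
have -> : n%:R * e = \sum_(k < n) e by rewrite sumr_const card_ord mulr_natl.
apply: ler_sum => k _; rewrite -mulrBl normrM -[leRHS]mulr1.
apply: ler_pM => //; first exact: abe.
rewrite ger0_norm ?mulr_ge0 ?exprn_ge0 ?subr_ge0//.
by rewrite mulr_ile1 ?exprn_ge0 ?exprn_ile1 ?subr_ge0 ?lerBlDr ?lerDl.
Qed.

(** The value 0 at [k = 0] reflects that the sum starts at index 1. *)
Lemma bernstein_sum_mean {R : realType} (a : rseq R) n x :
  bernstein_sum a n x =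
  binomial_mean n (fun k => if k is j.+1 then a j / 'C(n, k)%:R else 0) x.
Proof.
rewrite bernstein_sumE /binomial_mean big_ord_recl /= mul0r add0r.
apply: eq_bigr => k _; rewrite /bump /= add1n.
by field; rewrite pnatr_eq0 -lt0n bin_gt0.
Qed.

Lemma leq_bin n k : (0 < k < n)%N -> (n <= 'C(n, k))%N.
Proof.
elim: n k => [//|n IH] [//|k] /= kn; rewrite binS.
have [kn'|nk] := ltnP k.+1 n.
  by rewrite -addn1 leq_add ?IH ?bin_gt0// ltnW// ltnW.
have -> : n = k.+1 by apply/eqP; rewrite eqn_leq nk.
by rewrite binn binSn add1n.
Qed.

Lemma leq_incr (mu : nat -> nat) n : {homo mu : i j / (i < j)%N} -> (n <= mu n)%N.
Proof.
by move=> mu_incr; elim: n => // n IH; rewrite (leq_ltn_trans IH)// mu_incr.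
Qed.

Lemma bernstein_extension {R : realType} (mu : nat -> nat) (f : R -> R) (e : R)
    (p : rseq R) (N L : nat) :
  {homo mu : i j / (i < j)%N} ->
  {within `[0, 1], continuous f} -> f 0 = 0 -> 0 < e ->
  exists (n : nat) (a : rseq R), [/\ (L <= n)%N, agree N p a &
    forall x, 0 <= x <= 1 -> `|bernstein_sum a (mu n) x - f x| <= e].
Proof.
move=> mu_incr cf f0 e0; have e20 : 0 < e / 2 by rewrite divr_gt0.
have [M fM] := bernstein_approximation _ _ cf e20.
have [//|K K0 fK] := @quadratic_modulus R f (e / 4) cf.
  by rewrite divr_gt0.
(* At a prescribed index the error is at most [e / 4 + A / m]: [P / m] comes from [p], and
   [e / 4 + K * N / m] bounds [f] there, as [f 0 = 0]. *)
pose P := \sum_(k < N) `|p k|; pose A := K * N%:R + P.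
pose n := maxn (maxn L N.+1) (maxn M (Num.trunc (A / (e / 4))).+1).
pose m := mu n.
have nm : (n <= m)%N by exact: leq_incr.
have Ln : (L <= n)%N by rewrite !leq_max leqnn.
(* Strict, so that the binomial coefficients at the prescribed indices are at least [m]. *)
have Nm : (N < m)%N by rewrite (leq_trans _ nm)// !leq_max leqnn !orbT.
have Mm : (M <= m)%N by rewrite (leq_trans _ nm)// !leq_max leqnn !orbT.
have Am : A < e / 4 * m%:R.
  rewrite mulrC -ltr_pdivrMr ?divr_gt0// (lt_le_trans (truncnS_gt _))// ler_nat.
  by rewrite (leq_trans _ nm)// !leq_max leqnn !orbT.
have m0 : 0 < m%:R :> R by rewrite ltr0n (leq_trans _ Nm).
exists n, (fun k => if (k < N)%N then p k
  else f (k.+1%:R / m%:R) * 'C(m, k.+1)%:R); split => // [k ->//|x x01].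
rewrite -/m bernstein_sum_mean.
apply: le_trans (ler_distD (binomial_mean m (fun k => f (k%:R / m%:R)) x) _ _) _.
rewrite [leRHS]splitr lerD// ?fM// binomial_meanB -[leRHS](binomial_mean_cst m _ x).
apply: normr_binomial_mean => // -[|k] km.
  by rewrite mul0r f0 subrr normr0 ltW.
have Ck : 0 < 'C(m, k.+1)%:R :> R by rewrite ltr0n bin_gt0.
case: ltnP => kN; last by rewrite mulfK ?gt_eqF// subrr normr0 ltW.
have pk : `|p k / 'C(m, k.+1)%:R| <= P / m%:R.
  rewrite normrM normfV (gtr0_norm Ck) ler_pM ?invr_ge0//.
    by rewrite /P (bigD1 (Ordinal kN))//= lerDl sumr_ge0.
  rewrite lef_pV2 ?posrE// ler_nat leq_bin//=.
  exact: leq_ltn_trans Nm.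
have km01 : (0 <= k.+1%:R / m%:R :> R) && (k.+1%:R / m%:R <= 1 :> R).
  by rewrite divr_ge0//= ler_pdivrMr// mul1r ler_nat.
have := fK 0 (k.+1%:R / m%:R); rewrite km01 f0 !subr0 lexx ler01 => /(_ isT isT) fk.
have : K * (k.+1%:R / m%:R) ^+ 2 <= K * N%:R / m%:R.
  have /andP[j0 j1] := km01; rewrite -mulrA ler_wpM2l// expr2.
  by rewrite (le_trans (ler_piMl j0 j1))// ler_pM2r ?invr_gt0// ler_nat.
have : A / m%:R <= e / 4 by rewrite ler_pdivrMr// ltW.
have := ler_normB (p k / 'C(m, k.+1)%:R) (f (k.+1%:R / m%:R)).
rewrite /A mulrDl; lra.
Qed.

(** * Uniform convergence along subsequences *)

Lemma uniform_cvgP {R : realType} (F : nat -> R -> R) (f : R -> R) :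
  {uniform `[0, 1], F @ \oo --> f} <->
  forall e : R, 0 < e -> exists N, forall n, (N <= n)%N ->
    forall x, 0 <= x <= 1 -> `|F n x - f x| <= e.
Proof.
split=> [Ff e e0|H].
  have [|N _ HN] := Ff [set h | forall y, 0 <= y <= 1 -> `|h y - f y| <= e].
    apply/uniform_nbhs; exists [set xy | ball xy.1 e xy.2]; split.
      by rewrite -entourage_ballE; exists e.
    move=> h /= H y y01; have := H y; rewrite /ball /= in_itv /= distrC.
    by move=> /(_ y01)/ltW.
  by exists N => n Nn x x01; exact: (HN n).
move=> P /uniform_nbhs[E [/= [e /= e0 eE] EP]].
have [|N HN] := H (e / 2); first by rewrite divr_gt0.
exists N => // n Nn; apply: EP => y /=; rewrite in_itv /= => y01.
apply: eE; rewrite /ball /= distrC (le_lt_trans (HN n Nn y y01))//.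
by rewrite ltr_pdivrMr// ltr_pMr// ltr1n.
Qed.

(** Convergence along some subsequence of [mu], restated without naming the subsequence so that it
    becomes a countable list of conditions. *)
Definition approximates {R : realType} (mu : nat -> nat) (a : rseq R)
    (f : R -> R) : Prop :=
  forall (e : R) (L : nat), 0 < e -> exists2 n : nat, (L <= n)%N &
    forall x, 0 <= x <= 1 -> `|bernstein_sum a (mu n) x - f x| <= e.

Lemma exists_subsequence (P : nat -> nat -> Prop) :
  (forall i L, exists2 n, (L <= n)%N & P i n) ->
  exists2 phi : nat -> nat, {homo phi : i j / (i < j)%N} & forall i, P i (phi i).
Proof.
move=> H; have /choice[h Hh] : forall iL : nat * nat,
    exists n, (iL.2 <= n)%N /\ P iL.1 n.
  by move=> [i L]; have [n] := H i L; exists n.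
pose phi := fix phi i := if i is j.+1 then h (i, (phi j).+1) else h (0, 0)%N.
exists phi; last by case=> [|i]; exact: (Hh (_, _)).2.
apply: homo_ltn => [|i]; first exact: ltn_trans.
exact: (Hh (_, _)).1.
Qed.

Lemma approximatesP {R : realType} (mu : nat -> nat) (a : rseq R) (f : R -> R) :
  {homo mu : i j / (i < j)%N} ->
  approximates mu a f <-> exists lambda : nat -> nat,
    [/\ {homo lambda : i j / (i < j)%N}, range lambda `<=` range mu &
        {uniform `[0, 1], (fun n => bernstein_sum a (lambda n)) @ \oo --> f}].
Proof.
move=> mu_incr; split=> [af|[la [la_incr la_mu /uniform_cvgP laf]] e L e0].
  have [i L|phi phi_incr phiP] := @exists_subsequence (fun i n =>
    forall x, 0 <= x <= 1 -> `|bernstein_sum a (mu n) x - f x| <= i.+1%:R^-1).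
    by apply: af; rewrite invr_gt0.
  exists (mu \o phi); split.
  - by move=> i j ij; apply/mu_incr/phi_incr.
  - by move=> _ [i _ <-]; exists (phi i).
  apply/uniform_cvgP => e e0; exists (Num.trunc e^-1) => n en x x01.
  apply: le_trans (phiP n _ x01) _.
  rewrite -[leRHS]invrK lef_pV2 ?posrE ?invr_gt0// ltW//.
  by rewrite (lt_le_trans (truncnS_gt _))// ler_nat.
have [N HN] := laf e e0.
(* At rank [maxn N (mu L)] the value of [la] is at least [mu L], which forces [L <= n]. *)
have [n _ mun] := la_mu (la (maxn N (mu L))) (ex_intro2 _ _ _ I erefl).
exists n; last by move=> x x01; rewrite mun; apply: HN => //; rewrite leq_maxl.
rewrite leqNgt; apply/negP => /mu_incr; rewrite mun ltnNge.
by rewrite (leq_trans _ (leq_incr _ _ la_incr))// leq_maxr.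
Qed.

(** * Topology of the set of universal sequences *)

(** The sets containing a cylinder around [a] form a filter; it converges to [a] coordinatewise,
    since agreement up to [t.+1] fixes coordinate [t]. *)
Lemma agree_nbhs {R : realType} (a : rseq R) (O : set (rseq R)) :
  nbhs a O -> exists N, forall b, agree N a b -> O b.
Proof.
pose F : set_system (rseq R) := [set O | exists N, forall b, agree N a b -> O b].
have FF : Filter F.
  split; first by exists 0%N.
  - move=> A B [m Am] [n Bn]; exists (maxn m n) => b ab; split.
    + by apply: Am; apply: agreeW ab; rewrite leq_maxl.
    + by apply: Bn; apply: agreeW ab; rewrite leq_maxr.
  - by move=> A B AB [n An]; exists n => b /An/AB.
suff : F --> a by apply.
have : {ptws, F --> a}; last by [].
apply/pointwise_cvgP => t A At; exists t.+1 => b ab /=.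
by rewrite -ab//; exact: nbhs_singleton.
Qed.

Lemma nbhs_coordinates {R : realType} (a : rseq R) n (e : R) : 0 < e ->
  \forall b \near a, forall k, (k < n)%N -> `|b k - a k| < e.
Proof.
move=> e0; elim: n => [|n IH]; first by apply: (@filterE (rseq R) (nbhs a)).
have /cvgrPdist_lt/(_ _ e0) Hn : (fun b : rseq R => b n) @ a --> (a n : R^o).
  exact: (@proj_continuous nat (fun=> R^o) n a).
near=> b => k; rewrite ltnS leq_eqVlt => /predU1P[->|kn].
  by rewrite distrC; near: b; exact: Hn.
by move: k kn; near: b; exact: IH.
Unshelve. all: by end_near. Qed.

(** The functions [bernstein_sum (rat_seq c) (size c)] are a countable family of tests, uniformly
    dense among the continuous functions vanishing at 0. *)
Definition rat_seq {R : realType} (c : seq rat) : rseq R := fun k => ratr c`_k.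

(* [r < 1 / (j + 1)] rather than a pointwise strict bound makes this set
   visibly open. *)
Definition near_rational {R : realType} (mu : nat -> nat) (q : seq rat * nat * nat) :
    set (rseq R) :=
  let: (c, j, L) := q in
  [set a | exists2 n, (L <= n)%N & exists2 r, r < j.+1%:R^-1 &
    forall x, 0 <= x <= 1 ->
      `|bernstein_sum a (mu n) x - bernstein_sum (rat_seq c) (size c) x| <= r].

Lemma open_near_rational {R : realType} mu q : open (@near_rational R mu q).
Proof.
case: q => -[c j] L; rewrite openE => a [n Ln [r rj Hr]].
pose d := j.+1%:R^-1 - r; have d0 : 0 < d by rewrite subr_gt0.
(* Moving [mu n] terms by at most [e] costs at most half of the slack [d]; the successor avoids a
   zero denominator. *)
pose e := d / (2 * (mu n).+1%:R).
have e0 : 0 < e by rewrite divr_gt0// mulr_gt0.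
apply: filterS (@nbhs_coordinates R a (mu n) e e0) => b ab.
exists n => //; exists (r + d / 2).
  by rewrite -ltrBDl ltr_pdivrMr// ltr_pMr// ltr1n.
move=> x x01; apply: le_trans (ler_distD (bernstein_sum a (mu n) x) _ _) _.
rewrite addrC lerD ?Hr//.
have /le_trans := @bernstein_sum_dist R b a (mu n) e x x01 (fun k kn => ltW (ab k kn)).
apply; rewrite /e mulrA ler_pdivrMr ?mulr_gt0//.
have -> : d / 2 * (2 * (mu n).+1%:R) = d * (mu n).+1%:R by field.
by rewrite mulrC ler_pM2l// ler_nat.
Qed.

(** Extending the empty prefix along [id] gives real coefficients; rounding them costs at most
    [e / 2] in total. *)
Lemma rational_bernstein_approximation {R : realType} (f : R -> R) (e : R) :
  {within `[0, 1], continuous f} -> f 0 = 0 -> 0 < e ->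
  exists c : seq rat, forall x, 0 <= x <= 1 ->
    `|bernstein_sum (rat_seq c) (size c) x - f x| <= e.
Proof.
move=> cf f0 e0; have e20 : 0 < e / 2 by rewrite divr_gt0.
have id_incr : {homo id : i j / (i < j)%N} by [].
have [n [a [_ _ Ha]]] :=
  bernstein_extension _ _ _ (0 : rseq R) 0 0 id_incr cf f0 e20.
have en0 : 0 < e / 2 / n.+1%:R by rewrite divr_gt0.
have /choice[q Hq] : forall k, exists q : rat, `|ratr q - a k| <= e / 2 / n.+1%:R.
  move=> k; have /rat_in_itvoo[q] : a k < a k + e / 2 / n.+1%:R by rewrite ltrDl.
  rewrite in_itv => /andP[q1 q2]; exists q.
  by rewrite ger0_norm ?subr_ge0 ?(ltW q1)// lerBlDl ltW.
exists (mkseq q n) => x x01; rewrite size_mkseq.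
apply: le_trans (ler_distD (bernstein_sum a n x) _ _) _.
rewrite [leRHS]splitr lerD ?Ha//.
have qa k : (k < n)%N -> `|rat_seq (mkseq q n) k - a k| <= e / 2 / n.+1%:R.
  by move=> kn; rewrite /rat_seq nth_mkseq.
apply: le_trans (bernstein_sum_dist _ _ _ _ _ x01 qa) _.
by rewrite mulrA ler_pdivrMr// mulrC ler_pM2l// ler_nat.
Qed.

Lemma universalE {R : realType} (mu : nat -> nat) (a : rseq R) :
  {homo mu : i j / (i < j)%N} ->
  universal mu a <-> forall q, near_rational mu q a.
Proof.
move=> mu_incr; split=> [ua [[c j] L]|H f cf f0].
  pose f : R -> R := bernstein_sum (rat_seq c) (size c).
  have cf : {within `[0, 1], continuous f}.
    exact/continuous_subspaceT/continuous_bernstein_sum.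
  have e0 : 0 < j.+1%:R^-1 / 2 :> R by rewrite divr_gt0 ?invr_gt0.
  have /approximatesP /(_ _ L e0)[//|n Ln Hn] := ua f cf (bernstein_sum_at0 _ _).
  exists n => //; exists (j.+1%:R^-1 / 2) => //.
  by rewrite ltr_pdivrMr// ltr_pMr ?invr_gt0// ltr1n.
apply/(approximatesP _ _ _ mu_incr) => e L e0.
have e20 : 0 < e / 2 by rewrite divr_gt0.
have [c Hc] := rational_bernstein_approximation _ _ cf f0 e20.
have [n Ln [r rj Hr]] := H (c, Num.trunc (e / 2)^-1, L).
exists n => // x x01.
apply: le_trans (ler_distD (bernstein_sum (rat_seq c) (size c) x) _ _) _.
rewrite [leRHS]splitr lerD ?Hc//.
apply: le_trans (Hr x x01) _; rewrite (le_trans (ltW rj))//.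
rewrite -[leRHS]invrK lef_pV2 ?posrE ?invr_gt0// ltW//.
exact: truncnS_gt.
Qed.

Lemma Gdelta_universal {R : realType} (mu : nat -> nat) :
  {homo mu : i j / (i < j)%N} -> Gdelta (@universal R mu).
Proof.
move=> mu_incr.
(* Integers that code no condition contribute the whole space. *)
exists (fun i => if unpickle i is Some q then near_rational mu q else setT).
  by move=> i; case: unpickle => [q|]; [exact: open_near_rational|exact: openT].
apply/seteqP; split=> a.
  by move=> /(universalE _ _ mu_incr) H i _; case: unpickle.
move=> H; apply/(universalE _ _ mu_incr) => q.
by have := H (pickle q) I; rewrite pickleK.
Qed.

(* Baire category for the topology of agreement on initial segments. *)
Lemma prefix_baire {T : Type} (P : nat -> (nat -> T) -> Prop) (p : nat -> T) N :
  (forall i a n, exists (b : nat -> T) m, [/\ (n <= m)%N, agree n a b &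
     forall c, agree m b c -> P i c]) ->
  exists2 a, agree N p a & forall i, P i a.
Proof.
move=> H; have /choice[h Hh] : forall s : nat * ((nat -> T) * nat),
    exists t : (nat -> T) * nat, [/\ (s.2.2 < t.2)%N, agree s.2.2 s.2.1 t.1 &
      forall c, agree t.2 t.1 c -> P s.1 c].
  move=> [i [a n]]; have [b [m [nm ab bP]]] := H i a n.
  exists (b, m.+1); split => //= c bc; apply: bP; apply: agreeW bc; exact: leqnSn.
(* [s i] is the current sequence with the length of its frozen prefix. *)
pose s := fix s i := if i is j.+1 then h (j, s j) else (p, N).
have s_incr i j : (i <= j)%N -> ((s i).2 <= (s j).2)%N.
  move=> /subnKC <-; elim: (j - i)%N => [|d IH]; first by rewrite addn0.
  by rewrite addnS (leq_trans IH)// ltnW//; have [] := Hh ((i + d)%N, s (i + d)%N).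
have s_agree i j : (i <= j)%N -> agree (s i).2 (s i).1 (s j).1.
  move=> /subnKC <-; elim: (j - i)%N => [|d IH]; first by rewrite addn0.
  rewrite addnS; apply: agree_trans IH _.
  apply: (agreeW _ _ _ _ (s_incr _ _ (leq_addr d i))).
  by have [] := Hh ((i + d)%N, s (i + d)%N).
have s_large i : (i <= (s i).2)%N.
  elim: i => // i IH; rewrite (leq_ltn_trans IH)//.
  by have [] := Hh (i, s i).
pose a k := (s k.+1).1 k.
have sa i : agree (s i).2 (s i).1 a.
  move=> k ki; have [ik|ki'] := leqP i k.+1; first exact: s_agree.
  by rewrite /a [RHS](s_agree _ _ (ltnW ki')).
exists a; first exact: (sa 0).
by move=> i; have [_ _] := Hh (i, s i); apply; exact: (sa i.+1).
Qed.

Lemma exists_universal {R : realType} (mu : nat -> nat) (p : rseq R) N :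
  {homo mu : i j / (i < j)%N} -> exists2 a, agree N p a & universal mu a.
Proof.
move=> mu_incr.
have [|a pa Ha] := prefix_baire (fun i => if unpickle i is Some q
    then @near_rational R mu q else setT) p N.
  move=> i a n; case: unpickle => [[[c j] L]|]; last by exists a, n.
  have e0 : 0 < j.+1%:R^-1 / 2 :> R by rewrite divr_gt0 ?invr_gt0.
  pose f : R -> R := bernstein_sum (rat_seq c) (size c).
  have cf : {within `[0, 1], continuous f}.
    exact/continuous_subspaceT/continuous_bernstein_sum.
  have [m [b [Lm ab Hb]]] :=
    bernstein_extension _ _ _ a n L mu_incr cf (bernstein_sum_at0 _ _) e0.
  (* Freezing [mu m] terms freezes the sum of index [mu m], so the condition survives later
     choices. *)
  exists b, (maxn n (mu m)); split => // [|d bd]; first exact: leq_maxl.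
  exists m => //; exists (j.+1%:R^-1 / 2).
    by rewrite ltr_pdivrMr// ltr_pMr ?invr_gt0// ltr1n.
  move=> x x01; rewrite -(eq_bernstein_sum b) ?Hb//.
  by apply: agreeW bd; exact: leq_maxr.
exists a => //; apply/(universalE _ _ mu_incr) => q.
by have := Ha (pickle q); rewrite pickleK.
Qed.

Lemma dense_agree {R : realType} (S : set (rseq R)) :
  (forall p N, exists2 a, agree N p a & S a) -> dense S.
Proof.
move=> H O [p Op] Oo; have [N HN] := agree_nbhs _ _ (open_nbhs_nbhs (conj Oo Op)).
by have [a pa Sa] := H p N; exists a; split => //; exact: HN.
Qed.

(** * A dense subspace *)

(** Phrased with the values of [nu] rather than their ranks, so that it passes to smaller ranges
    without reindexing. *)
Definition vanishes {R : realType} (nu : nat -> nat) (a : rseq R) : Prop :=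
  forall e : R, 0 < e -> exists L, forall m, range nu m -> (L <= m)%N ->
    forall x, 0 <= x <= 1 -> `|bernstein_sum a m x| <= e.

Lemma vanishes_sub {R : realType} (mu nu : nat -> nat) (a : rseq R) :
  range nu `<=` range mu -> vanishes mu a -> vanishes nu a.
Proof.
by move=> numu va e /va[L HL]; exists L => m /numu; exact: HL.
Qed.

Lemma vanishes0 {R : realType} nu : vanishes nu (0 : rseq R).
Proof.
by move=> e e0; exists 0%N => m _ _ x _; rewrite bernstein_sum0 normr0 ltW.
Qed.

Lemma vanishes_lin {R : realType} nu (c : R) (a b : rseq R) :
  vanishes nu a -> vanishes nu b -> vanishes nu (c *: a + b).
Proof.
move=> va vb e e0.
have [|L HL] := va (e / 2 / (`|c| + 1)); first by rewrite !divr_gt0 ?ltr_wpDl.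
have [|K HK] := vb (e / 2); first by rewrite divr_gt0.
exists (maxn L K) => m num; rewrite geq_max => /andP[Lm Km] x x01.
rewrite bernstein_sumD bernstein_sumZ (le_trans (ler_normD _ _))//.
rewrite [leRHS]splitr lerD ?HK// normrM.
have := HL m num Lm x x01; rewrite ler_pdivlMr ?ltr_wpDl//.
by apply: le_trans; rewrite mulrDr mulr1 mulrC lerDl.
Qed.

Lemma uniform_vanishes {R : realType} (la : nat -> nat) (a : rseq R) :
  {homo la : i j / (i < j)%N} ->
  {uniform `[0, 1], (fun n => bernstein_sum a (la n)) @ \oo --> (fun=> 0 : R)} ->
  vanishes la a.
Proof.
move=> la_incr /uniform_cvgP H e /H[N HN]; exists (la N) => _ [n _ <-] Nn x x01.
rewrite -[X in `|X|]subr0; apply: HN x01; rewrite leqNgt; apply/negP => /la_incr.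
by rewrite ltnNge Nn.
Qed.

(** Along [nu], the sums of [a] can approach [c^-1 * f] while those of [b] only add an error tending
    to 0. *)
Lemma universal_lin {R : realType} (mu nu : nat -> nat) (c : R) (a b : rseq R) :
  range nu `<=` range mu -> c != 0 -> universal nu a -> vanishes nu b ->
  universal mu (c *: a + b).
Proof.
move=> numu c0 ua vb f cf f0.
have [||la [la_incr la_nu /uniform_cvgP H]] := ua (fun x => c^-1 * f x).
- by move=> x; apply: cvgMr; exact: cf.
- by rewrite f0 mulr0.
exists la; split => //; first exact: subset_trans numu.
apply/uniform_cvgP => e e0.
have [|N HN] := H (e / 2 / `|c|); first by rewrite !divr_gt0 ?normr_gt0.
have [|L HL] := vb (e / 2); first by rewrite divr_gt0.
exists (maxn N L) => n; rewrite geq_max => /andP[Nn Ln] x x01.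
rewrite bernstein_sumD bernstein_sumZ.
have -> : c * bernstein_sum a (la n) x + bernstein_sum b (la n) x - f x =
    c * (bernstein_sum a (la n) x - c^-1 * f x) + bernstein_sum b (la n) x.
  by field.
rewrite (le_trans (ler_normD _ _))// [leRHS]splitr lerD//.
  have := HN n Nn x x01.
  by rewrite ler_pdivlMr ?normr_gt0// normrM mulrC.
by apply: HL => //; [exact: la_nu|rewrite (leq_trans Ln)// leq_incr].
Qed.

Lemma exists_universal_tower {R : realType} (mu : nat -> nat) :
  {homo mu : i j / (i < j)%N} ->
  exists (a : nat -> rseq R) (nu : nat -> nat -> nat), forall j,
  [/\ agree j.+1 (fun k => (k == j)%:R) (a j), universal (nu j) (a j),
      vanishes (nu j.+1) (a j), range (nu j.+1) `<=` range (nu j) &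
      range (nu j) `<=` range mu].
Proof.
move=> mu_incr.
have /choice[h Hh] : forall s : (nat -> nat) * nat,
    exists t : rseq R * (nat -> nat), {homo s.1 : i j / (i < j)%N} ->
    [/\ {homo t.2 : i j / (i < j)%N}, agree s.2.+1 (fun k => (k == s.2)%:R) t.1,
        universal s.1 t.1, vanishes t.2 t.1 & range t.2 `<=` range s.1].
  move=> [nu j] /=; have [nu_incr|//] := pselect {homo nu : i j / (i < j)%N}.
    have [a ja ua] :=
      @exists_universal R nu (fun k => (k == j)%:R) j.+1 nu_incr.
    have [||la [la_incr la_nu Hla]] := ua (fun=> 0) _ _ => //.
      exact: cst_continuous.
    by exists (a, la) => _; split => //; exact: uniform_vanishes.
  (* Dummy value: the recursion only meets increasing sequences. *)
  by exists (0, id).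
pose nu := fix nu j := if j is i.+1 then (h (nu i, i)).2 else mu.
have nu_incr j : {homo nu j : i k / (i < k)%N}.
  by elim: j => [|j IH]; [exact: mu_incr|have [] := Hh (nu j, j) IH].
have nu_sub j : range (nu j.+1) `<=` range (nu j).
  by have [] := Hh (nu j, j) (nu_incr j).
have nu_mu j : range (nu j) `<=` range mu.
  by elim: j => [//|j IH]; exact: subset_trans (nu_sub j) IH.
exists (fun j => (h (nu j, j)).1), nu => j.
by have [? ? ? ? ?] := Hh (nu j, j) (nu_incr j); split.
Qed.

Lemma universal_dense_subspace {R : realType} (mu : nat -> nat) :
  {homo mu : i j / (i < j)%N} ->
  exists W : set (rseq R),
    [/\ linear_subspace W, dense W & contains_apart_from_0 (universal mu) W].
Proof.
move=> mu_incr; have [a [nu H]] := @exists_universal_tower R mu mu_incr.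
pose comb n (c : nat -> R) : rseq R := \sum_(i < n) c i *: a i.
have combS n c : comb n.+1 c = c n *: a n + comb n c.
  by rewrite /comb big_ord_recr addrC.
have eq_comb n c d : agree n c d -> comb n c = comb n d.
  by move=> cd; apply: eq_bigr => i _; rewrite cd.
have comb_vanishes n c : vanishes (nu n) (comb n c).
  elim: n => [|n IH]; first by rewrite /comb big_ord0; exact: vanishes0.
  have [_ _ va numu _] := H n; rewrite combS; apply: vanishes_lin => //.
  exact: vanishes_sub IH.
(* Trailing zero coefficients are dropped; then [c n] multiplies a sequence universal along [nu n],
   where the rest vanishes. *)
have comb_universal n c : comb n c <> 0 -> universal mu (comb n c).
  elim: n => [|n IH]; first by rewrite /comb big_ord0.
  rewrite combS; have [->|c0 _] := eqVneq (c n) 0; first by rewrite scale0r add0r.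
  by have [_ ua _ _ numu] := H n; exact: universal_lin (comb_vanishes n c).
exists [set w | exists n c, w = comb n c]; split.
- split; first by rewrite inE; exists 0%N, (fun=> 0); rewrite /comb big_ord0.
  move=> k _ _ /set_mem[m [c ->]] /set_mem[n [d ->]]; rewrite inE.
  have widen p q (e : nat -> R) : (p <= q)%N ->
      comb p e = comb q (fun i => if (i < p)%N then e i else 0).
    move=> pq; rewrite /comb (big_ord_widen q (fun i => e i *: a i))// big_mkcond.
    by apply: eq_bigr => i _; case: ifP => // _; rewrite scale0r.
  rewrite (widen m (maxn m n)) ?leq_maxl// (widen n (maxn m n) d) ?leq_maxr//.
  eexists; eexists (fun i => k * (if (i < m)%N then c i else 0) +
    (if (i < n)%N then d i else 0)).
  rewrite /comb scaler_sumr -big_split; apply: eq_bigr => i _ /=.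
  by rewrite scalerA -scalerDl.
- apply: dense_agree => p N.
  suff [c Hc] : exists c, agree N p (comb N c).
    by exists (comb N c) => //; exists N, c.
  elim: N => [|N [c Hc]]; first by exists (fun=> 0).
  (* Triangular solving: [a N] is 0 before [N] and 1 at [N], so its coefficient corrects coordinate
     [N] alone among the first [N.+1]. *)
  exists (fun i => if (i < N)%N then c i else p N - comb N c N) => k.
  rewrite combS ltnn (eq_comb _ _ c) => [|i ->//].
  have [aN _ _ _ _] := H N.
  have -> : ((p N - comb N c N) *: a N + comb N c) k =
    (p N - comb N c N) * a N k + comb N c k by [].
  rewrite ltnS leq_eqVlt => /predU1P[->|kN].
    by rewrite -aN// eqxx mulr1 subrK.
  by rewrite -aN ?ltnS 1?ltnW// (ltn_eqF kN) mulr0 add0r Hc.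
- by move=> w [[n [c ->]]] c0; exact: comb_universal.
Qed.

(** * Absence of closed infinite-dimensional subspaces *)

(* [P(t) - 2^m P(t/2)] has one coefficient less than [P]. *)
Lemma coefficients_bounded {R : realType} m :
  exists2 C : R, 0 <= C & forall (a : nat -> R) B,
    (forall t, 0 <= t <= 1 -> `|\sum_(k < m) a k * t ^+ k| <= B) ->
    forall k, (k < m)%N -> `|a k| <= C * B.
Proof.
elim: m => [|m [C C0 IH]]; first by exists 0.
pose D := C * (1 + 2 ^+ m); have D0 : 0 <= D by rewrite mulr_ge0// addr_ge0.
exists (D + (1 + m%:R * D)); first by rewrite !addr_ge0// mulr_ge0.
move=> a B aB.
have B0 : 0 <= B.
  by apply: le_trans (aB 0 _); rewrite ?normr_ge0// lexx ler01.
have low k : (k < m)%N -> `|a k| <= D * B.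
  (* The difference multiplies [a k] by [1 - 2 ^+ (m - k)], of modulus at least 1 for [k < m]. *)
  move=> km; have := IH (fun k => a k * (1 - 2 ^+ (m - k))) ((1 + 2 ^+ m) * B).
  move=> /(_ _ k km); rewrite mulrA -/D => H; apply: le_trans (H _).
    rewrite normrM ler_peMr// distrC ger0_norm.
      rewrite lerBrDr -[leLHS]/(2 ^+ 1) ler_weXn2l ?ler1n// subn_gt0//.
    by rewrite subr_ge0 exprn_ege1// ler1n.
  move=> t /andP[t0 t1].
  have -> : \sum_(j < m) a j * (1 - 2 ^+ (m - j)) * t ^+ j =
      \sum_(j < m.+1) a j * t ^+ j - 2 ^+ m * \sum_(j < m.+1) a j * (t / 2) ^+ j.
    rewrite mulr_sumr -sumrB [RHS]big_ord_recr /=.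
    rewrite [X in _ = _ + X](_ : _ = 0) ?addr0; last first.
      by rewrite exprMn exprVn; field; rewrite expf_neq0.
    apply: eq_bigr => j _.
    have -> : 2 ^+ m = 2 ^+ (m - j) * 2 ^+ j :> R by rewrite -exprD subnK// ltnW.
    by rewrite exprMn exprVn; field; rewrite expf_neq0.
  rewrite (le_trans (ler_normB _ _))// mulrDl mul1r lerD ?aB ?t0//.
  rewrite normrM ger0_norm ?exprn_ge0// ler_wpM2l ?exprn_ge0// aB//.
  by rewrite divr_ge0//= ler_pdivrMr// mul1r (le_trans t1)// ler1n.
move=> k; rewrite ltnS leq_eqVlt => /predU1P[->|/low /le_trans]; last first.
  by apply; rewrite ler_wpM2r// lerDl addr_ge0// mulr_ge0.
(* The top coefficient is recovered from the value at 1. *)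
have -> : a m = \sum_(j < m.+1) a j * 1 ^+ j - \sum_(j < m) a j.
  rewrite big_ord_recr /= expr1n mulr1 addrAC.
  rewrite [X in X - _](eq_bigr (fun j : 'I_m => a j)) ?subrr ?add0r// => j _.
  by rewrite expr1n mulr1.
rewrite (le_trans (ler_normB _ _))// -[leLHS]add0r mulrDl lerD ?mulr_ge0//.
rewrite mulrDl mul1r lerD ?aB ?ler01 ?lexx//.
apply: le_trans (ler_norm_sum _ _ _) _.
have -> : m%:R * D * B = \sum_(j < m) (D * B).
  by rewrite sumr_const card_ord -mulrA mulr_natl.
by apply: ler_sum => j _; exact: low.
Qed.

(* The substitution [x = t / (1 + t)] turns [(1 + t)^m * S_m a] into a polynomial
   in [t] whose coefficients are the terms of [a]. *)
Lemma bernstein_coefficients_bounded {R : realType} m :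
  exists C : R, forall a : rseq R,
    (forall x, 0 <= x <= 1 -> `|bernstein_sum a m x| <= 1) ->
    forall k, (k < m)%N -> `|a k| <= C.
Proof.
have [C C0 HC] := @coefficients_bounded R m.+1.
exists (C * 2 ^+ m) => a a1 k km.
(* The polynomial in [t] has no constant term and carries [a i] in degree [i.+1]; [2 ^+ m] bounds
   [(1 + t) ^+ m]. *)
have := HC (fun j => if j is i.+1 then a i else 0) (2 ^+ m).
move=> /(_ _ k.+1 km); apply=> t /andP[t0 t1].
have t10 : 0 < 1 + t by rewrite ltr_pwDl.
have t1n0 : 1 + t != 0 by rewrite gt_eqF.
have -> : \sum_(j < m.+1) (if j : nat is i.+1 then a i else 0) * t ^+ j =
    (1 + t) ^+ m * bernstein_sum a m (t / (1 + t)).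
  rewrite big_ord_recl /= mul0r add0r bernstein_sumE mulr_sumr.
  apply: eq_bigr => i _; rewrite /bump /= add1n.
  have -> : 1 - t / (1 + t) = (1 + t)^-1 by field.
  have -> : (1 + t) ^+ m = (1 + t) ^+ i.+1 * (1 + t) ^+ (m - i.+1).
    by rewrite -exprD subnKC.
  by rewrite exprMn !exprVn; field; rewrite !expf_neq0.
rewrite normrM ger0_norm ?exprn_ge0 ?(ltW t10)// -[leRHS]mulr1 ler_pM//.
- by rewrite exprn_ge0// ltW.
- by rewrite lerXn2r ?nnegrE ?(ltW t10)//; lra.
- by apply: a1; rewrite divr_ge0 ?(ltW t10)//= ler_pdivrMr// mul1r lerDr.
Qed.

(** The first [N] coordinates determine a vector of [W]. The induction cuts [W] by the hyperplane
    [w N = 0] and adds at most one vector outside it. *)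
Lemma subspace_finite_dimensional {R : realType} (W : set (rseq R)) N :
  linear_subspace W -> (forall w, W w -> agree N 0 w -> w = 0) ->
  finite_dimensional W.
Proof.
elim: N W => [|N IH] W Wlin W0.
  exists 0%N, (fun=> 0); split => [[]//|w /W0->//].
  by exists (fun=> 0); rewrite big_ord0.
pose W' : set (rseq R) := [set w | W w /\ w N = 0].
have W'lin : linear_subspace W'.
  have [/set_mem W_0 W_lin] := Wlin; split; first by rewrite inE; split.
  move=> c u v /set_mem[Wu u0] /set_mem[Wv v0]; rewrite inE; split.
    by apply/set_mem/W_lin; rewrite inE.
  by rewrite -[LHS]/(c * u N + v N) u0 v0 mulr0 addr0.
have [|n [e [We We_span]]] := IH W' W'lin.
  move=> w [Ww w0] wN; apply: W0 => // k.
  by rewrite ltnS leq_eqVlt => /predU1P[->//|]; exact: wN.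
have [[v [Wv vN]]|noW] := pselect (exists v, W v /\ v N <> 0); last first.
  exists n, e; split => [i|w Ww]; first by case: (We i).
  apply: We_span; split => //; apply: contrapT => wN.
  by apply: noW; exists w.
exists n.+1, (fun i => if unlift ord0 i is Some j then e j else v); split.
  by move=> i; case: unliftP => [j _|_//]; case: (We j).
move=> w Ww; pose d := w N / v N.
have [c Hc] : exists c : 'I_n -> R, (- d) *: v + w = \sum_(i < n) c i *: e i.
  apply: We_span; split; first by apply/set_mem/(Wlin.2 (- d)); rewrite inE.
  rewrite -[LHS]/(- d * v N + w N) /d mulNr mulfVK ?addNr//.
  exact/eqP.
exists (fun i => if unlift ord0 i is Some j then c j else d).
rewrite big_ord_recl unlift_none.
under eq_bigr do rewrite liftK.
by rewrite -Hc addrA -scalerDl subrr scale0r add0r.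
Qed.

Lemma infinite_dimensional_leading_term {R : realType} (W : set (rseq R)) N :
  linear_subspace W -> ~ finite_dimensional W ->
  exists (w : rseq R) nu, [/\ (N <= nu)%N, W w, agree nu 0 w & w nu = 1].
Proof.
move=> Wlin Winf.
have [w [Ww wN w0]] : exists w, [/\ W w, agree N 0 w & w <> 0].
  apply: contrapT => H; apply: Winf.
  apply: (subspace_finite_dimensional W N) => // w Ww wN.
  by apply: contrapT => w0; apply: H; exists w.
have exw : exists k, w k != 0.
  apply: contrapT => H; apply: w0; apply/funext => k.
  by apply/eqP; apply: contrapT => /negP wk; apply: H; exists k.
case: (ex_minnP exw) => nu wnu nu_min.
(* The summand 0 matches the form [c *: u + v] in which closure of [W] is stated. *)
exists ((w nu)^-1 *: w + 0), nu; split.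
- by rewrite leqNgt; apply/negP => /wN nuN; move: wnu; rewrite -nuN eqxx.
- by apply/set_mem/Wlin.2; rewrite ?Wlin.1// inE.
- move=> k knu; rewrite addr0 -[RHS]/((w nu)^-1 * w k).
  have [->|/nu_min] := eqVneq (w k) 0; first by rewrite mulr0.
  by rewrite leqNgt knu.
- by rewrite addr0 -[LHS]/((w nu)^-1 * w nu) mulVf.
Qed.

Lemma not_spaceable_universal {R : realType} (mu : nat -> nat) :
  {homo mu : i j / (i < j)%N} -> ~ spaceable (@universal R mu).
Proof.
move=> mu_incr [W [Wlin Wclosed Winf Wmu]].
have /choice[C HC] := @bernstein_coefficients_bounded R.
have /choice[g Hg] : forall N, exists t : rseq R * nat,
    [/\ (N <= t.2)%N, W t.1, agree t.2 0 t.1 & t.1 t.2 = 1].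
  move=> N; have [w [nu H]] := infinite_dimensional_leading_term W N Wlin Winf.
  by exists (w, nu).
pose t := fix t j := if j is i.+1 then g (t i).2.+1 else g 0.
pose nu j := (t j).2; pose w j := (t j).1.
have nuS j : (nu j < nu j.+1)%N by have [] := Hg (nu j).+1.
have nu_incr : {homo nu : i j / (i < j)%N}.
  by apply: homo_ltn => // ? ? ?; exact: ltn_trans.
have nu_le i j : (i <= j)%N -> (nu i <= nu j)%N.
  by rewrite leq_eqVlt => /predU1P[->//|/nu_incr/ltnW].
have Ht j : [/\ W (w j), agree (nu j) 0 (w j) & w j (nu j) = 1].
  by case: j => [|j]; [have [] := Hg 0|have [] := Hg (nu j).+1].
pose M j : R := 1 + \sum_(m < (nu j.+1).+1) `|C m|.
have CM j m : (m <= nu j.+1)%N -> C m < M j.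
  move=> mnu; apply: le_lt_trans (_ : \sum_(i < (nu j.+1).+1) `|C i| < _).
    rewrite (le_trans (ler_norm _))// (bigD1 (Ordinal (mnu : m < _.+1)%N))//=.
    by rewrite lerDl sumr_ge0.
  by rewrite /M ltrDr.
(* The coefficient of [w i] is chosen to make the term at [nu i] equal to [M i]; later vectors
   vanish there. *)
pose s := fix s j : rseq R :=
  if j is i.+1 then (M i - s i (nu i)) *: w i + s i else 0.
have sS j k : s j.+1 k = (M j - s j (nu j)) * w j k + s j k by [].
have Ws j : W (s j).
  elim: j => [|j IH]; first exact/set_mem/Wlin.1.
  by apply/set_mem/Wlin.2; rewrite inE//; have [] := Ht j.
have s_agree i j : (i <= j)%N -> agree (nu i) (s i) (s j).
  move=> /subnKC <-; elim: (j - i)%N => [|d IH]; first by rewrite addn0.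
  rewrite addnS; apply: agree_trans IH _ => k ki; have [_ w0 _] := Ht (i + d)%N.
  by rewrite sS -w0 ?mulr0 ?add0r// (leq_trans ki)// nu_le// leq_addr.
have s_nu j : s j.+1 (nu j) = M j.
  by rewrite sS; have [_ _ ->] := Ht j; rewrite mulr1 subrK.
pose a : rseq R := fun k => s k.+1 k.
have sa j : agree (nu j) (s j) a.
  move=> k kj; have [jk|kj'] := leqP j k.+1; first exact: s_agree.
  by rewrite /a [RHS](s_agree _ _ (ltnW kj'))//; exact: leq_incr.
have a_nu j : a (nu j) = M j by rewrite -(sa j.+1).
have Wa : W a.
  (* [a] is the limit of the partial combinations [s N], so closedness applies. *)
  apply: Wclosed => B /agree_nbhs[N HN]; exists (s N); split => //; apply: HN.
  by move=> k kN; rewrite (sa N)// (leq_trans kN)// leq_incr.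
have M1 j : 1 <= M j by rewrite /M lerDl sumr_ge0.
have a0 : a <> 0.
  move=> a0; have := M1 0%N; rewrite -a_nu a0.
  by rewrite -[X in _ <= X]/(0 : R) ler10.
have ua : universal mu a by apply: Wmu.
have /(approximatesP _ _ _ mu_incr)/(_ 1 (nu 0).+1 ltr01)[n nun Hn] :=
  ua (fun=> 0) (@cst_continuous _ _ _) erefl.
have {nun} : (nu 0 < mu n)%N by rewrite (leq_trans nun)// leq_incr.
(* For this [j], the sum of index [mu n] involves the term [M j] at [nu j], and [M j] exceeds
   [C (mu n)]. *)
move=> mun; have [j nuj munj] : exists2 j, (nu j < mu n)%N & (mu n <= nu j.+1)%N.
  elim: (mu n) mun => // m IH; rewrite ltnS leq_eqVlt => /predU1P[<-|/IH].
    by exists 0%N.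
  move=> [j jm mj]; have [mj'|mj'] := ltnP m (nu j.+1).
    by exists j => //; exact: ltnW.
  by exists j.+1 => //; rewrite ?ltnS// (leq_ltn_trans mj).
have := HC (mu n) a _ _ nuj; rewrite a_nu => H.
have : M j <= C (mu n).
  apply: le_trans (ler_norm _) (H _) => x x01.
  by have := Hn x x01; rewrite subr0.
by rewrite leNgt CM.
Qed.

Theorem theorem3p2 (R : realType) (mu : nat -> nat)
    (mu_incr : {homo mu : i j / (i < j)%N}) :
  (exists a : rseq R, universal mu a) /\
  [/\ dense (@universal R mu),
      Gdelta (@universal R mu),
      exists W : set (rseq R), [/\ linear_subspace W, dense W &
        contains_apart_from_0 (universal mu) W] &
      ~ spaceable (@universal R mu)].
Proof.
split; first by have [a _ ua] := @exists_universal R mu 0 0 mu_incr; exists a.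
split.
- by apply: dense_agree => p N; exact: exists_universal.
- exact: Gdelta_universal.
- exact: universal_dense_subspace.
- exact: not_spaceable_universal.
Qed.
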